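(* Let $0\le q<1$ and let $\Theta$ be the class of $d\times d$ density matrices $\rho$ whose Pauli coefficients satisfy $\sum_{k=2}^{d^2}|\beta_k|^q\le \pi_n(d)$. Assume $n^{c_0}\le d\le e^{n^{c_1}}$ for some constants $c_0>0$ and $c_1<1$. Let $\hat\rho$ be the (hard or soft) thresholding density matrix estimator with threshold $\varpi=\hbar\sqrt{(4/n)\log d}$ for some constant $\hbar>1$. Then there are constants $c_2,c_3$ free of $n$ and $d$ such that $$\sup_{\rho\in\Theta}E\big[\|\hat\rho-\rho\|_2^2\big]\le c_2\,\pi_n^2(d)\,\frac1{d^2}\Big(\frac{\log d}{n}\Big)^{1-q},$$ $$\sup_{\rho\in\Theta}E\big[\|\hat\rho-\rho\|_F^2\big]\le c_3\,\pi_n(d)\,\frac1{d}\Big(\frac{\log d}{n}\Big)^{1-q/2}.$$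
   Context: Let $d=2^b$, $b$ a positive integer. Let $\sigma_0=I_2$ and let $\sigma_1,\sigma_2,\sigma_3$ be the usual $2\times2$ Pauli matrices. The $d$-dimensional Pauli matrices are the $d^2$ tensor products $\sigma_{\ell_1}\otimes\cdots\otimes\sigma_{\ell_b}$, $(\ell_1,\dots,\ell_b)\in\{0,1,2,3\}^b$, enumerated as $B_1,\dots,B_{d^2}$ with $B_1=I_d$ (i.e. $\ell_1=\cdots=\ell_b=0$). A density matrix is a $d\times d$ complex Hermitian positive semidefinite matrix of trace $1$; every density matrix has a unique expansion $\rho=\frac{I_d}{d}+\sum_{j=2}^{d^2}\beta_j\frac{B_j}{d}$ with real $\beta_j$ (its Pauli coefficients). Data: $N_2,\dots,N_{d^2}$ are independent, and $N_j$ is the average of $n$ i.i.d. random variables with values $\pm1$ taken with probabilities $\mathrm{tr}(\rho Q_{j\pm})$, where $Q_{j\pm}$ are the projections onto the eigenspaces of $B_j$ for the eigenvalues $\pm1$; equivalently $n(N_j+1)/2\sim\mathrm{Bin}(n,(1+\beta_j)/2)$. Thresholding estimator: $\hat\beta_k=N_k1(|N_k|\ge\varpi)$ for all $k$ (hard) or $\hat\beta_k=\mathrm{sign}(N_k)(|N_k|-\varpi)_+$ for all $k$ (soft), $k=2,\dots,d^2$, and $\hat\rho=\frac{I_d}{d}+\sum_{k=2}^{d^2}\hat\beta_k\frac{B_k}{d}$. $\|\cdot\|_2$ is the spectral (operator) norm and $\|\cdot\|_F$ the Frobenius norm. In the sparsity condition, when $q=0$, $|\beta|^0$ means $1(\beta\ne0)$.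 $\pi_n(d)$ is a deterministic function with slow growth in $d$, such as $\log d$; in particular $\pi_n(d)\ge1$. Statements are asymptotic for large $n$ and $d$; ''constants free of $n$ and $d$'' may depend on $q,c_0,c_1,\hbar$. *)

(* Defs.v *)
From HB Require Import structures.
From mathcomp Require Import all_boot all_order all_algebra.
From mathcomp Require Import complex.
From mathcomp Require mxtens.
From mathcomp Require Import all_classical all_reals all_analysis.

Set Implicit Arguments.
Unset Strict Implicit.
Unset Printing Implicit Defensive.

Import Order.TTheory GRing.Theory Num.Theory.

Local Open Scope classical_set_scope.
Local Open Scope ring_scope.
Local Open Scope complex_scope.
Local Open Scope sesquilinear_scope.

Definition pauli2 {R : realType} (l : 'I_4) : 'M[R[i]]_2 :=
  match val l with
  | 0 => 1%:M
  | 1 => \matrix_(i, j) (i != j)%:R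
  | 2 => \matrix_(i, j) if i == j then 0 else if i == 0 then - 'i else 'i
  | _ => \matrix_(i, j) if i == j then (-1) ^+ i else 0
  end.

Fixpoint pauli_tensor {R : realType} (b : nat) : ('I_b -> 'I_4) -> 'M[R[i]]_(2 ^ b) :=
  match b with
  | 0 => fun _ => 1%:M
  | b'.+1 => fun l =>
      castmx (esym (expnS 2 b'), esym (expnS 2 b'))
        (mxtens.tensmx (pauli2 (l ord0)) (pauli_tensor (fun i => l (lift ord0 i))))
  end.

(* The index set {2, ..., d ^ 2} of the nonidentity Pauli matrices B_k: all
   label sequences (l_1, ..., l_b) other than (0, ..., 0). *)
Definition pauli_index (b : nat) : finType :=
  {l : {ffun 'I_b -> 'I_4} | l != [ffun=> ord0]}.

Definition pauli {R : realType} {b : nat} (k : pauli_index b) : 'M[R[i]]_(2 ^ b) :=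
  pauli_tensor (val k).

Definition psdmx {R : realType} {d : nat} (A : 'M[R[i]]_d) : Prop :=
  forall x : 'cV[R[i]]_d, 0 <= (x ^t* *m A *m x) 0 0.

Definition density_matrix {R : realType} {d : nat} (A : 'M[R[i]]_d) : Prop :=
  [/\ A \is hermsymmx, psdmx A & \tr A = 1].

Definition pauli_expansion {R : realType} {b : nat} (beta : pauli_index b -> R) :
    'M[R[i]]_(2 ^ b) :=
  ((2 ^ b)%:R)^-1 *: (1%:M + \sum_k (beta k)%:C *: pauli k).

(* |x|^q with |x|^0 = 1(x != 0), unlike powR for which 0 `^ 0 = 1. *)
Definition abs_pow {R : realType} (q x : R) : R :=
  if q == 0 then (x != 0)%:R else `|x| `^ q.

Definition sparse_density {R : realType} (b : nat) (q s : R) :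
    set 'M[R[i]]_(2 ^ b) :=
  [set rho | density_matrix rho /\
     exists beta : pauli_index b -> R,
       rho = pauli_expansion beta /\ \sum_k abs_pow q (beta k) <= s].

(* eigenspace and proj_ortho follow the row-vector convention. For Hermitian B
   and real a, u *m B = a *: u iff B *m u ^t* = a *: u ^t*, and the orthogonal
   projection matrix is Hermitian, so this is also the matrix that projects
   column vectors onto the eigenspace of B for a. *)
Definition eigenproj {R : realType} {d : nat} (B : 'M[R[i]]_d) (a : R[i]) :
    'M[R[i]]_d := proj_ortho (eigenspace B a).

(* Re only extracts the real number from a trace that is real for Hermitian
   rho. *)
Definition born_prob {R : realType} {d : nat} (rho Q : 'M[R[i]]_d) : R :=
  complex.Re (\tr (rho *m Q)).

Definition mutually_independent {R : realType} {disp : measure_display}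
    {T : measurableType disp} (P : probability T R) (I : finType)
    (X : I -> T -> R) : Prop :=
  forall (J : {set I}) (A : I -> set R), (forall i, measurable (A i)) ->
    P (\bigcap_(i in [set` J]) X i @^-1` A i) =
    (\prod_(i in J) P (X i @^-1` A i))%E.

Definition pauli_mean {R : realType} {disp : measure_display}
    {T : measurableType disp} {b n : nat}
    (X : pauli_index b -> 'I_n -> {mfun T >-> R}) (k : pauli_index b) (t : T) : R :=
  (\sum_i X k i t) / n%:R.

(* Independence across k is required of the averages N_k only; the individual
   outcomes are assumed independent for each fixed k. *)
Definition pauli_data {R : realType} {disp : measure_display}
    {T : measurableType disp} {b n : nat} (rho : 'M[R[i]]_(2 ^ b))
    (P : probability T R) (X : pauli_index b -> 'I_n -> {mfun T >-> R}) : Prop :=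
  [/\ forall k i t, X k i t = 1 \/ X k i t = -1,
      forall k i,
        P (X k i @^-1` [set 1]) = (born_prob rho (eigenproj (pauli k) 1))%:E /\
        P (X k i @^-1` [set -1]) = (born_prob rho (eigenproj (pauli k) (-1)))%:E,
      forall k, mutually_independent P (X k)
    & mutually_independent P (pauli_mean X)].

Variant thresholding := Hard | Soft.

Definition threshold {R : realType} (r : thresholding) (w x : R) : R :=
  match r with
  | Hard => if w <= `|x| then x else 0
  | Soft => Num.sg x * Num.max (`|x| - w) 0
  end.

Definition threshold_level {R : realType} (h : R) (n d : nat) : R :=
  h * Num.sqrt (4 / n%:R * ln d%:R).

Definition rho_hat {R : realType} {disp : measure_display}
    {T : measurableType disp} {b n : nat} (r : thresholding) (h : R)
    (X : pauli_index b -> 'I_n -> {mfun T >-> R}) (t : T) : 'M[R[i]]_(2 ^ b) :=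
  pauli_expansion
    (fun k => threshold r (threshold_level h n (2 ^ b)) (pauli_mean X k t)).

Definition cmod {R : realType} (z : R[i]) : R := complex.Re `|z|.

Definition l2norm {R : realType} {d : nat} (x : 'cV[R[i]]_d) : R :=
  Num.sqrt (\sum_i cmod (x i 0) ^+ 2).

Definition spectral_norm {R : realType} {d : nat} (A : 'M[R[i]]_d) : R :=
  sup [set l2norm (A *m x) | x in [set x : 'cV[R[i]]_d | l2norm x = 1]].

Definition frobenius_norm {R : realType} {d : nat} (A : 'M[R[i]]_d) : R :=
  Num.sqrt (\sum_i \sum_j cmod (A i j) ^+ 2).

(* The supremum over rho in Theta of the mean squared loss of rho_hat, where
   P rho is the law of the data when the true state is rho. *)
Definition max_risk {R : realType} {disp : measure_display}
    {T : measurableType disp} {b n : nat}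
    (norm : 'M[R[i]]_(2 ^ b) -> R) (Theta : set 'M[R[i]]_(2 ^ b))
    (P : 'M[R[i]]_(2 ^ b) -> probability T R)
    (r : thresholding) (h : R)
    (X : pauli_index b -> 'I_n -> {mfun T >-> R}) : \bar R :=
  ereal_sup
    [set ('E_(P rho)[fun t => (norm (rho_hat r h X t - rho) ^+ 2)%R])%E
       | rho in Theta].

(* Main.v *)
Require Import Defs.
From HB Require Import structures.
From mathcomp Require Import all_boot all_order all_algebra.
From mathcomp Require Import complex ring lra.
From mathcomp Require mxtens.
From mathcomp Require Import all_classical all_reals all_analysis.
From mathcomp Require Import measurable_realfun.

Set Implicit Arguments.
Unset Strict Implicit.
Unset Printing Implicit Defensive.

Import Order.TTheory GRing.Theory Num.Theory.

Local Open Scope classical_set_scope.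
Local Open Scope ring_scope.

(** Write [L = ln d / n], [t = 2 sqrt L] and [h t] for the threshold, and let
    [N_k] be the empirical mean attached to the Pauli matrix [B_k].

    Linear algebra turns both losses into losses on coefficients.  The Pauli
    matrices are Hermitian involutions, so [B_k] is an isometry and the
    triangle inequality bounds the spectral norm of [rho_hat - rho] by
    [(1/d) sum_k |D_k|], where [D_k] is the error on the [k]-th coefficient;
    they are orthogonal with [tr (B_j B_k) = d] if [j = k] and [0] otherwise,
    so the squared Frobenius norm is exactly [(1/d) sum_k D_k^2].  Since an
    involution [B] has spectral projections [(1 +- B)/2], the outcomes for
    [B_k] have mean [tr (rho B_k) = beta_k].

    Thresholding then gives a deterministic estimate ([threshold_error]): with
    [y_k = N_k - beta_k],
      [|D_k| <= C (min (|beta_k|, t) + |y_k| 1(|y_k| > t))],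
    where [C] depends on [h] only.  The first term is controlled by sparsity,
    because [min (|beta|, t) <= |beta|^q t^(1-q)].

    The second term is where [h > 1] matters: it leaves room for the deviation
    level [t], strictly below the threshold, at which the sharp Hoeffding
    constant gives [P (|y_k| > t) <= 2 exp (- n t^2 / 2) = 2 / d^2], exactly
    enough to sum over fewer than [d^2] coefficients.  Bounding [|y_k|] by a
    constant on that event would lose the factor [t]; instead
    [|y| 1(|y| > t)] and its square are bounded by [t Z] and [t^2 Z], where [Z]
    is the sum of two exponentials that occurs in Chernoff's method and has
    mean at most [2 / d^2].  For the Frobenius loss linearity of the
    expectation concludes; the spectral bound is the square of a sum, whose
    cross terms have to factor, and this is where independence of the [N_k] is
    used ([fin_expect_sqr_sum]).  The remainder is
    [O(t^2) = O(L)], which is below the announced rates as [L <= 1].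

    Only finitely many outcomes are possible, so all expectations are computed
    as finite sums against the law of the whole table of outcomes.  This makes
    every loss a function on a finite set, and disposes of measurability and
    integrability. *)

(** * The sharp exponential moment of a two-point variable *)

Lemma le_at0_derive_le0 (R : realType) (f f' : R -> R) :
  (forall x : R, is_derive x (1 : R) f (f' x)) -> (forall x, 0 <= x -> f' x <= 0) ->
  forall s, 0 <= s -> f s <= f 0.
Proof.
move=> df f'0 s s0.
have dr x : derivable f x 1 by case: (df x).
apply: (@ler0_derive1_nincry _ f 0) => //.
- move=> x; rewrite in_itv /= andbT => x0.
  by rewrite derive1E; have -> := @derive_val _ _ _ _ _ _ _ (df x); exact/f'0/ltW.
- by apply: derivable_within_continuous => x _.
Qed.

(** [H] stands for a combination of [cosh] and [sinh] and [G] for its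
    derivative.  The logarithmic derivative [G / H] grows at most linearly, as
    its own derivative is [1 - (G / H)^2]; integrating
    [(ln H)' s <= b + s] gives the claim.  Logarithms are avoided by
    showing that [H s * expR (- (s b + s^2 / 2))] decreases. *)
Lemma hyperbolic_le_expR (R : realType) (H G : R -> R) (b : R) :
  (forall x : R, is_derive x (1 : R) H (G x)) ->
  (forall x : R, is_derive x (1 : R) G (H x)) ->
  (forall x, 0 < H x) -> H 0 = 1 -> G 0 = b ->
  forall s, 0 <= s -> H s <= expR (s * b + s ^+ 2 / 2).
Proof.
move=> dH dG H_gt0 H0 G0 s s0.
have GH x : 0 <= x -> G x - (b + x) * H x <= 0.
  move=> x0; rewrite subr_le0 -ler_pdivrMr // -lerBlDr.
  pose u (y : R) := G y / H y - y.
  have ub : u 0 = b by rewrite /u G0 H0 divr1 subr0.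
  rewrite -[leRHS]ub.
  apply: (@le_at0_derive_le0 _ u (fun y => - (G y / H y) ^+ 2)) => // y.
    have Hy : H y != 0 by rewrite gt_eqF.
    have dV : is_derive y (1 : R) (fun z => (H z)^-1) (- (H y) ^- 2 *: G y).
      by apply: DeriveDef; [exact: derivableV | rewrite deriveV // derive_val].
    apply: is_derive_eq; rewrite /GRing.scale /=; field.
    exact: Hy.
  by rewrite oppr_le0 sqr_ge0.
pose E (x : R) := expR (- (x * b + x ^+ 2 / 2)).
have dE (x : R) : is_derive x (1 : R) E (- (b + x) * E x).
  by apply: is_derive_eq; rewrite /GRing.scale /= /E; field.
have E0 : E 0 = 1 by rewrite /E mul0r expr0n mul0r addr0 oppr0 expR0.
have : H s * E s <= H 0 * E 0.
  apply: (@le_at0_derive_le0 _ (fun y => H y * E y)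
           (fun x => (G x - (b + x) * H x) * E x)) => // x.
    by apply: is_derive_eq; rewrite /GRing.scale /=; ring.
  by move=> x0; rewrite mulr_le0_ge0 ?expR_ge0 // GH.
by rewrite H0 E0 mulr1 /E expRN ler_pdivrMr ?expR_gt0 // mul1r.
Qed.

(** Hoeffding's lemma for a variable with values [1] and [-1] and mean [b].  The
    constant [1/2] in the exponent is what makes the deviation level
    [2 sqrt (ln d / n)] exceptional with probability [2 / d^2] only. *)
Lemma hoeffding_rademacher (R : realType) (b s : R) : -1 <= b <= 1 ->
  (1 + b) / 2 * expR s + (1 - b) / 2 * expR (- s) <= expR (s * b + s ^+ 2 / 2).
Proof.
wlog s0 : b s / 0 <= s => [hw b1|].
  have [s0|s0] := leP 0 s; first exact: hw.
  case/andP: b1 => b0 b1; have := hw (- b) (- s); rewrite mulrNN sqrrN !opprK.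
  by rewrite addrC; apply; [rewrite oppr_ge0 ltW|rewrite lerN2 b1 lerNl].
move=> /andP[b0 b1].
(* The sign [e] lets one family contain both [H] and its derivative. *)
pose w (e x : R) := (1 + b) / 2 * expR x + e * ((1 - b) / 2 * expR (- x)).
have dw (e x : R) : is_derive x (1 : R) (w e) (w (- e) x).
  by apply: is_derive_eq; rewrite /w /GRing.scale /=; ring.
have -> : (1 + b) / 2 * expR s + (1 - b) / 2 * expR (- s) = w 1 s.
  by rewrite /w mul1r.
apply: (@hyperbolic_le_expR _ (w 1) (w (-1))) => //.
- by move=> x; have := dw (-1) x; rewrite opprK.
- move=> x; rewrite /w mul1r.
  have := expR_gt0 x; have := expR_gt0 (- x).
  have [->|bn] := eqVneq b 1; first by nra.
  have : b < 1 by rewrite lt_neqAle bn.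
  by nra.
- by rewrite /w oppr0 expR0; field.
- by rewrite /w oppr0 expR0; field.
Qed.

(** * Deterministic estimates on thresholding *)

(** If the deviation is at most [t], a coefficient that survives the threshold
    [h t] satisfies [|b| >= (h - 1) t] and one that is killed satisfies
    [|b| <= (h + 1) t]; in both cases the error is at most a multiple
    of [min (|b|, t)].  A deviation larger than [t] exceeds the threshold up to
    the factor [h], and so bounds the error by itself. *)
Lemma threshold_error (R : realType) (r : thresholding) (h t x b : R) :
  1 < h -> 0 < t ->
  `|threshold r (h * t) x - b| <=
  (h + 1) * h / (h - 1) * (Num.min `|b| t + `|x - b| * (t < `|x - b|)%R%:R).
Proof.
move=> h1 t0; set w := h * t; set D := threshold r w x - b.
have h10 : 0 < h - 1 by rewrite subr_gt0.
have hh1 : 0 < (h + 1) / (h - 1) by rewrite divr_gt0 //; lra.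
have xb : `|x| <= `|b| + `|x - b| by rewrite -{1}[x](subrK b) addrC ler_normD.
have bx : `|b| <= `|x| + `|x - b|.
  by rewrite [`|x - b|]distrC -{1}[b](subrK x) addrC ler_normD.
(* Hard and soft thresholding enter only through this dichotomy. *)
have : `|x| <= w /\ `|D| = `|b| \/ w <= `|x| /\ `|D| <= `|x - b| + w.
  rewrite /D; case: r {D} => /=; case: (leP w `|x|) => wx.
  - by right; split=> //; rewrite lerDl mulr_ge0; lra.
  - by left; rewrite sub0r normrN ltW.
  - right; split => //; rewrite max_l ?subr_ge0 // mulrBr mulr_sg_norm.
    rewrite addrAC (le_trans (ler_normB _ _)) // lerD2l normrM normr_sg.
    have w0 : 0 <= w by rewrite mulr_ge0; lra.
    by rewrite (ger0_norm w0) ler_piMl // lern1 leq_b1.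
  - by left; rewrite max_r ?subr_le0 1?ltW // mulr0 sub0r normrN.
have cE : (h + 1) * h / (h - 1) = (h + 1) + (h + 1) / (h - 1) by field; lra.
set y := `|x - b| in xb bx *; set B := `|b| in xb bx *.
have y0 : 0 <= y := normr_ge0 _.
have B0 : 0 <= B := normr_ge0 _.
have m0 : 0 <= Num.min B t by rewrite le_min B0 ltW.
have [ty|yt] := ltP t y; rewrite ?mulr1 ?mulr0 ?addr0.
  move=> H; have DB : `|D| <= (h + 1) * y.
    have hty : h * t <= h * y by rewrite ler_wpM2l ?ltW //; lra.
    rewrite mulrDl mul1r; rewrite /w in H; case: H => -[H1 H2]; lra.
  apply: (le_trans DB); rewrite cE.
  have : 0 <= (h + 1) / (h - 1) * (Num.min B t + y).
    by rewrite mulr_ge0 ?addr_ge0 // ltW.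
  nra.
rewrite cE; case=> -[H1 H2].
- apply: (@le_trans _ _ ((h + 1) * Num.min B t)).
    have hB : 0 <= h * B by rewrite mulr_ge0; lra.
    by rewrite H2; case: (leP B t) => _; rewrite mulrDl mul1r; rewrite /w in H1; lra.
  by rewrite [leRHS]mulrDl lerDl mulr_ge0 // ltW.
- have tB : t <= (h - 1)^-1 * B.
    by rewrite mulrC ler_pdivlMr //; rewrite mulrBr mulr1 mulrC; rewrite /w in H1; lra.
  have Dt : `|D| <= (h + 1) * t by rewrite mulrDl mul1r; rewrite /w in H2; lra.
  have h1h : 0 <= h + 1 by lra.
  rewrite [leRHS]mulrDl; case: (leP B t) => _.
    have := ler_wpM2l h1h tB; rewrite mulrA => DB.
    have : 0 <= (h + 1) * B by exact: mulr_ge0.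
    by lra.
  by apply: (le_trans Dt); rewrite lerDl mulr_ge0 // ltW.
Qed.

(** Replaces the integration of tail probabilities: beyond [t] the functions
    [|y| / t] and [(|y| / t)^2] are below [expR (2 (|y| / t - 1))], hence below
    the exponential of Chernoff's bound as soon as its parameter [l] is at
    least [2 / t]. *)
Lemma expR_dominates_tail (R : realType) (l t y : R) : 0 < t -> 2 <= l * t ->
  (`|y| * (t < `|y|)%R%:R) ^+ 2 <=
    t ^+ 2 * (expR (l * (y - t)) + expR (l * (- y - t))) /\
  `|y| * (t < `|y|)%R%:R <= t * (expR (l * (y - t)) + expR (l * (- y - t))).
Proof.
move=> t0 lt2; have l0 : 0 < l by nra.
set Z := _ + _.
have Z0 : 0 <= Z by rewrite addr_ge0 ?expR_ge0.
have [ty|_] := ltP t `|y|; last first.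
  by rewrite mulr0 expr0n /=; split; rewrite mulr_ge0 ?sqr_ge0 // ltW.
rewrite mulr1.
have yZ : expR (l * (`|y| - t)) <= Z.
  by rewrite /Z; case: (ger0P y) => _; rewrite ?lerDl ?lerDr ?expR_ge0.
pose v := `|y| / t.
have v1 : 1 < v by rewrite ltr_pdivlMr // mul1r.
have yv : `|y| = t * v by rewrite /v mulrC divfK // gt_eqF.
have v2 : v ^+ 2 <= Z.
  apply: le_trans yZ; apply: (@le_trans _ _ (expR (v - 1) ^+ 2)).
    have := expR_ge1Dx (v - 1); rewrite addrC subrK => ev.
    by rewrite ler_sqr ?nnegrE ?expR_ge0 //; lra.
  by rewrite expr2 -expRD ler_expR yv; nra.
rewrite yv exprMn; split; first by rewrite ler_wpM2l // sqr_ge0.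
by rewrite ler_wpM2l ?(ltW t0) // (le_trans _ v2) //; nra.
Qed.

(** A weighted geometric mean of [|b|] and [t] lies above their minimum; the
    convention [|b|^0 = 1(b != 0)] fits because the minimum vanishes at
    [b = 0]. *)
Lemma min_le_abs_pow (R : realType) (q b t : R) : 0 <= q -> q < 1 -> 0 < t ->
  Num.min `|b| t <= abs_pow q b * t `^ (1 - q).
Proof.
move=> q0 q1 t0; rewrite /abs_pow.
have [->|b0] := eqVneq b 0.
  have [_|qn] := eqVneq q 0; first by rewrite normr0 mul0r ge_min lexx.
  by rewrite normr0 powR0 // mul0r ge_min lexx.
have [->|qn] := eqVneq q 0.
  by rewrite subr0 (powRr1 (ltW t0)) mul1r ge_min lexx orbT.
have nb : 0 < `|b| by rewrite normr_gt0.
have E (x : R) : 0 < x -> x `^ q * x `^ (1 - q) = x.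
  move=> x0; rewrite -powRD; last by rewrite (gt_eqF x0) implybT.
  by rewrite addrC subrK powRr1 // ltW.
case: (leP `|b| t) => bt.
  rewrite -{1}(E _ nb) ler_wpM2l ?powR_ge0 // ge0_ler_powR ?nnegrE //; lra.
rewrite -{1}(E _ t0) ler_wpM2r ?powR_ge0 // ge0_ler_powR ?nnegrE //; lra.
Qed.

Lemma sqr_min_le_abs_pow (R : realType) (q b t : R) : 0 <= q -> q < 1 -> 0 < t ->
  Num.min `|b| t ^+ 2 <= abs_pow q b * (t ^+ 2) `^ (1 - q / 2).
Proof.
move=> q0 q1 t0.
have m0 : 0 <= Num.min `|b| t by rewrite le_min normr_ge0 ltW.
have -> : (t ^+ 2) `^ (1 - q / 2) = t `^ (1 - q) * t.
  rewrite -(powR_mulrn _ (ltW t0)) -powRrM.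
  have -> : 2%:R * (1 - q / 2) = 1 - q + 1 by field.
  by rewrite powRD ?(powRr1 (ltW t0)) // (gt_eqF t0) implybT.
rewrite mulrA expr2 ler_pM ?min_le_abs_pow //.
by rewrite ge_min lexx orbT.
Qed.

(** * Finite probability *)

Definition fin_expect (R : realType) (W : finType) (p F : W -> R) : R :=
  \sum_w p w * F w.

Definition fin_prob (R : realType) (W : finType) (p : W -> R) (S : pred W) : R :=
  \sum_(w | S w) p w.

Lemma fin_probE (R : realType) (W : finType) (p : W -> R) (S : pred W) :
  fin_prob p S = fin_expect p (fun w => (S w)%:R).
Proof.
rewrite /fin_prob big_mkcond; apply: eq_bigr => w _.
by case: ifP => _; rewrite ?mulr1 ?mulr0.
Qed.

Lemma fin_expect_le (R : realType) (W : finType) (p F G : W -> R) :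
  (forall w, 0 <= p w) -> (forall w, F w <= G w) ->
  fin_expect p F <= fin_expect p G.
Proof. by move=> p0 FG; apply: ler_sum => w _; rewrite ler_wpM2l. Qed.

Lemma fin_expectD (R : realType) (W : finType) (p F G : W -> R) :
  fin_expect p (fun w => F w + G w) = fin_expect p F + fin_expect p G.
Proof.
by rewrite /fin_expect -big_split; apply: eq_bigr => w _; rewrite mulrDr.
Qed.

Lemma fin_expectZ (R : realType) (W : finType) (p F : W -> R) (c : R) :
  fin_expect p (fun w => c * F w) = c * fin_expect p F.
Proof.
by rewrite /fin_expect mulr_sumr; apply: eq_bigr => w _; rewrite mulrCA.
Qed.

Lemma fin_expect_sum (R : realType) (W I : finType) (p : W -> R) (F : I -> W -> R) :
  fin_expect p (fun w => \sum_i F i w) = \sum_i fin_expect p (F i).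
Proof.
rewrite /fin_expect exchange_big /=; apply: eq_bigr => w _.
by rewrite mulr_sumr.
Qed.

Lemma fin_expect_cst (R : realType) (W : finType) (p : W -> R) (c : R) :
  \sum_w p w = 1 -> fin_expect p (fun=> c) = c.
Proof. by move=> p1; rewrite /fin_expect -mulr_suml p1 mul1r. Qed.

(** Independence is only known for the events [Y i = v i]; expanding each
    [g i (Y i)] over the finitely many values of the [Y i] and distributing the
    product over the sums reduces to them. *)
Lemma fin_expect_prod (R : realType) (W I : finType) (p : W -> R)
    (g : I -> R -> R) (Y : I -> W -> R) :
  (forall v : I -> R, fin_prob p (fun w => [forall i, Y i w == v i]) =
     \prod_i fin_prob p (fun w => Y i w == v i)) ->
  fin_expect p (fun w => \prod_i g i (Y i w)) =
  \prod_i fin_expect p (fun w => g i (Y i w)).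
Proof.
move=> indep.
(* One common list of values for all the [Y i] makes the product of sums
   a sum over functions into a fixed finite type. *)
pose vals := [seq Y x.1 x.2 | x : I * W].
have valsP i w : Y i w \in vals by apply/mapP; exists (i, w); rewrite ?mem_enum.
pose V := seq_sub vals.
have gE i w : g i (Y i w) = \sum_(v : V) (Y i w == val v)%:R * g i (val v).
  rewrite (bigD1 (SeqSub (valsP i w) : V)) //= eqxx mul1r big1 ?addr0 // => v.
  by rewrite -val_eqE /= eq_sym => /negbTE ->; rewrite mul0r.
have EgE i : fin_expect p (fun w => g i (Y i w)) =
    \sum_(v : V) fin_prob p (fun w => Y i w == val v) * g i (val v).
  rewrite /fin_expect; under eq_bigr do rewrite gE mulr_sumr.
  rewrite exchange_big /=; apply: eq_bigr => v _.
  by rewrite fin_probE mulr_suml; apply: eq_bigr => w _; rewrite mulrA.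
under [RHS]eq_bigr do rewrite EgE.
rewrite bigA_distr_bigA /=.
rewrite -(eq_fun (_ : forall w, \sum_(f : {ffun I -> V})
    \prod_i ((Y i w == val (f i))%:R * g i (val (f i))) = _)); last first.
  move=> w.
  rewrite -(bigA_distr_bigA (fun i (v : V) => (Y i w == val v)%:R * g i (val v))).
  by apply: eq_bigr => i _; rewrite gE.
rewrite fin_expect_sum; apply: eq_bigr => f _.
rewrite big_split /= -(indep (fun i => val (f i))).
rewrite fin_probE mulr_suml; apply: eq_bigr => w _.
rewrite big_split /= mulrA; congr (_ * _); congr (_ * _).
case: forallP => [H|/forallP]; first by rewrite big1 // => i _; rewrite H.
rewrite negb_forall => /existsP[i /negbTE Yi].
by rewrite (bigD1 i) //= Yi mul0r.
Qed.

Lemma fin_expect_mul (R : realType) (W I : finType) (p : W -> R) (Y : I -> W -> R)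
    (g : I -> R -> R) (j k : I) :
  \sum_w p w = 1 ->
  (forall v : I -> R, fin_prob p (fun w => [forall i, Y i w == v i]) =
     \prod_i fin_prob p (fun w => Y i w == v i)) -> j != k ->
  fin_expect p (fun w => g j (Y j w) * g k (Y k w)) =
  fin_expect p (fun w => g j (Y j w)) * fin_expect p (fun w => g k (Y k w)).
Proof.
move=> p1 indep jk.
pose G i x := if (i == j) || (i == k) then g i x else 1.
have prod2 (F : I -> R) : \prod_i (if (i == j) || (i == k) then F i else 1) = F j * F k.
  rewrite (bigD1 j) //= eqxx (bigD1 k) 1?eq_sym //= eqxx orbT big1 ?mulr1 // => i.
  by case/andP => /negbTE -> /negbTE ->.
have := fin_expect_prod G indep.
under eq_fun do rewrite prod2.
have -> : \prod_i fin_expect p (fun w => G i (Y i w)) =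
    \prod_i (if (i == j) || (i == k) then fin_expect p (fun w => g i (Y i w)) else 1).
  by apply: eq_bigr => i _; rewrite /G; case: ifP => // _; rewrite fin_expect_cst.
by rewrite prod2.
Qed.

(** With Cauchy-Schwarz in place of the factorisation of the cross terms, the
    second summand would be [#|I|^2 e2], too large by a factor of order [1/e2]
    when [e1] and [e2] are both of order [1/#|I|]. *)
Lemma fin_expect_sqr_sum (R : realType) (W I : finType) (p : W -> R)
    (F : I -> W -> R) (e1 e2 : R) :
  (forall k, 0 <= fin_expect p (F k) <= e1) ->
  (forall k, fin_expect p (fun w => F k w ^+ 2) <= e2) ->
  (forall j k, j != k -> fin_expect p (fun w => F j w * F k w) =
     fin_expect p (F j) * fin_expect p (F k)) ->
  fin_expect p (fun w => (\sum_k F k w) ^+ 2) <= #|I|%:R * e2 + (#|I|%:R * e1) ^+ 2.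
Proof.
move=> F1 F2 indep.
have E : fin_expect p (fun w => (\sum_k F k w) ^+ 2) =
    \sum_j \sum_k fin_expect p (fun w => F j w * F k w).
  rewrite (_ : (fun w => _) = (fun w => \sum_j \sum_k F j w * F k w)).
    by rewrite fin_expect_sum; apply: eq_bigr => j _; rewrite fin_expect_sum.
  by apply/funext => w; rewrite expr2 big_distrlr.
rewrite E.
have -> : #|I|%:R * e2 + (#|I|%:R * e1) ^+ 2 = \sum_(j : I) (e2 + \sum_(k : I) e1 ^+ 2).
  rewrite !sumr_const -[RHS]mulr_natl; rewrite -(mulr_natl (e1 ^+ 2)); ring.
apply: ler_sum => j _; rewrite (bigD1 j) //=; apply: lerD; first exact: F2.
rewrite [leRHS](bigD1 j) //= -[leLHS]add0r lerD ?sqr_ge0 //.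
apply: ler_sum => k kj; rewrite indep 1?eq_sym // expr2.
by case/andP: (F1 j) => ? ?; case/andP: (F1 k) => ? ?; exact: ler_pM.
Qed.

Lemma fin_expect_expR_sum (R : realType) (W : finType) (p : W -> R) n
    (X : 'I_n -> W -> R) (b s : R) :
  (forall i w, X i w = 1 \/ X i w = -1) ->
  (forall i, fin_prob p (fun w => X i w == 1) = (1 + b) / 2) ->
  (forall i, fin_prob p (fun w => X i w == -1) = (1 - b) / 2) ->
  (forall v : 'I_n -> R, fin_prob p (fun w => [forall i, X i w == v i]) =
     \prod_i fin_prob p (fun w => X i w == v i)) ->
  -1 <= b <= 1 ->
  fin_expect p (fun w => expR (s * \sum_i X i w)) <=
  expR (n%:R * (s * b + s ^+ 2 / 2)).
Proof.
move=> X1 Pp Pm indep b1.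
have -> : fin_expect p (fun w => expR (s * \sum_i X i w)) =
    \prod_i fin_expect p (fun w => expR (s * X i w)).
  rewrite -(fin_expect_prod (fun _ x => expR (s * x)) indep).
  by apply: eq_bigr => w _; rewrite mulr_sumr expR_sum.
have E i : fin_expect p (fun w => expR (s * X i w)) =
    (1 + b) / 2 * expR s + (1 - b) / 2 * expR (- s).
  rewrite -(Pp i) -(Pm i) !fin_probE ![_ * expR _]mulrC -!fin_expectZ -fin_expectD.
  apply: eq_bigr => w _; congr (_ * _); have n11 : (1 == -1 :> R) = false.
    by apply/eqP => h; have := @ltr01 R; lra.
  case: (X1 i w) => ->; rewrite ?eqxx 1?[-1 == 1]eq_sym n11
    ?mulr0 ?addr0 ?add0r ?mulr1 //.
  by rewrite mulrN1.
under eq_bigr do rewrite E.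
rewrite prodr_const card_ord expRM_natl lerXn2r ?nnegrE ?expR_ge0 //.
  by case/andP: b1 => ? ?; rewrite addr_ge0 // mulr_ge0 ?expR_ge0 //; lra.
exact: hoeffding_rademacher.
Qed.

(** Chernoff's method at the optimal parameter [n t]. *)
Lemma fin_expect_tail (R : realType) (W : finType) (p : W -> R) n
    (X : 'I_n -> W -> R) (y : W -> R) (b t : R) : (0 < n)%N ->
  (forall i w, X i w = 1 \/ X i w = -1) ->
  (forall i, fin_prob p (fun w => X i w == 1) = (1 + b) / 2) ->
  (forall i, fin_prob p (fun w => X i w == -1) = (1 - b) / 2) ->
  (forall v : 'I_n -> R, fin_prob p (fun w => [forall i, X i w == v i]) =
     \prod_i fin_prob p (fun w => X i w == v i)) ->
  -1 <= b <= 1 ->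
  (forall w, y w = (\sum_i X i w) / n%:R - b) ->
  fin_expect p (fun w => expR (n%:R * t * (y w - t)) + expR (n%:R * t * (- y w - t)))
  <= 2 * expR (- (n%:R * t ^+ 2 / 2)).
Proof.
move=> n0 X1 Pp Pm indep b1 yE.
have nn : n%:R != 0 :> R by rewrite pnatr_eq0 -lt0n.
(* [s] is [t] for the upper tail and [- t] for the lower one. *)
have half s : s ^+ 2 = t ^+ 2 ->
    fin_expect p (fun w => expR (n%:R * (s * y w - t ^+ 2))) <=
    expR (- (n%:R * t ^+ 2 / 2)).
  move=> st.
  have -> : fin_expect p (fun w => expR (n%:R * (s * y w - t ^+ 2))) =
      expR (- (n%:R * (s * b + t ^+ 2))) *
      fin_expect p (fun w => expR (s * \sum_i X i w)).
    rewrite -fin_expectZ; apply: eq_bigr => w _; rewrite -expRD; congr (_ * expR _).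
    by rewrite yE; field.
  have := fin_expect_expR_sum s X1 Pp Pm indep b1.
  rewrite -(ler_pM2l (expR_gt0 (- (n%:R * (s * b + t ^+ 2))))) => /le_trans; apply.
  by rewrite -expRD ler_expR st; lra.
rewrite fin_expectD mulrDl !mul1r; apply: lerD.
- have := half t erefl; congr (_ <= _).
  by apply: eq_bigr => w _; congr (_ * expR _); ring.
- have := half (- t) (sqrrN _); congr (_ <= _).
  by apply: eq_bigr => w _; congr (_ * expR _); ring.
Qed.

(** * From the underlying probability space to the finite law *)

Definition fibre_law (R : realType) (disp : measure_display) (T : measurableType disp)
    (P : probability T R) (W : finType) (w : T -> W) (a : W) : R :=
  fine (P (w @^-1` [set a])).

Lemma fibre_law_ge0 (R : realType) (disp : measure_display) (T : measurableType disp)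
    (P : probability T R) (W : finType) (w : T -> W) (a : W) :
  0 <= fibre_law P w a.
Proof. by rewrite fine_ge0. Qed.

Lemma expectation_fibre_law (R : realType) (disp : measure_display)
    (T : measurableType disp) (P : probability T R) (W : finType) (w : T -> W)
    (f : W -> R) :
  (forall a, measurable (w @^-1` [set a])) -> (forall a, 0 <= f a) ->
  ('E_P[fun t => f (w t)] = (fin_expect (fibre_law P w) f)%:E)%E.
Proof.
move=> mw f0; rewrite unlock.
have -> : (fun t => (f (w t))%:E) =
    (fun t => \sum_(a <- enum W) (f a)%:E * (\1_(w @^-1` [set a]) t)%:E)%E.
  apply/funext => t; rewrite big_enum /= (bigD1 (w t)) //= indicE mem_set //.
  rewrite mule1 big1 ?adde0 // => a aw; rewrite indicE memNset ?mule0 //=.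
  by apply/eqP; rewrite eq_sym.
rewrite ge0_integral_sum //.
- rewrite big_enum /= /fin_expect -sumEFin; apply: eq_bigr => a _.
  rewrite ge0_integralZl ?lee_fin //.
  + rewrite integral_indic // setIT /fibre_law EFinM fineK 1?muleC //.
    exact: fin_num_measure.
  + by apply/measurable_EFinP; exact: measurable_indic.
- move=> a; apply: measurable_funeM.
  by apply/measurable_EFinP; exact: measurable_indic.
- by move=> a t _; rewrite mule_ge0 ?lee_fin // indicE.
Qed.

Lemma probability_fibre_law (R : realType) (disp : measure_display)
    (T : measurableType disp) (P : probability T R) (W : finType) (w : T -> W)
    (S : pred W) :
  (forall a, measurable (w @^-1` [set a])) ->
  P [set t | S (w t)] = (fin_prob (fibre_law P w) S)%:E.
Proof.
move=> mw; rewrite fin_probE -expectation_fibre_law //.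
have mS : measurable [set t | S (w t)].
  have -> : [set t | S (w t)] = \bigcup_(a in [set` S]) w @^-1` [set a].
    by apply/seteqP; split=> [t St|t [a Sa /= ->//]]; exists (w t).
  apply: fin_bigcup_measurable => // a _; exact: mw.
rewrite -expectation_indic //; congr ('E_P[_])%E; apply/funext => t.
rewrite indicE; congr (_%:R); case: (boolP (S (w t))) => St.
  by rewrite mem_set.
by rewrite memNset //=; apply/negP.
Qed.

Lemma sum_fibre_law (R : realType) (disp : measure_display)
    (T : measurableType disp) (P : probability T R) (W : finType) (w : T -> W) :
  (forall a, measurable (w @^-1` [set a])) ->
  \sum_a fibre_law P w a = 1.
Proof.
move=> mw; have := probability_fibre_law P predT mw.
rewrite (_ : [set t | _] = setT) ?probability_setT; last by apply/seteqP.
by case.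
Qed.

Lemma fibre_law_indep (R : realType) (disp : measure_display)
    (T : measurableType disp) (P : probability T R) (W I : finType) (w : T -> W)
    (X : I -> T -> R) (Z : I -> W -> R) :
  (forall a, measurable (w @^-1` [set a])) ->
  (forall i t, X i t = Z i (w t)) -> mutually_independent P X ->
  forall v : I -> R,
    fin_prob (fibre_law P w) (fun a => [forall i, Z i a == v i]) =
    \prod_i fin_prob (fibre_law P w) (fun a => Z i a == v i).
Proof.
move=> mw XZ indep v.
have := indep [set: I]%SET (fun i => [set v i]) (fun i => measurable_set1 (v i)).
have -> : \bigcap_(i in [set` [set: I]%SET]) X i @^-1` [set v i] =
    [set t | [forall i, Z i (w t) == v i]].
  apply/seteqP; split => t /=.
    move=> H; apply/forallP => i; rewrite -XZ; apply/eqP; apply: H.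
    by rewrite /= inE.
  by move=> /forallP H i _ /=; rewrite XZ; exact/eqP.
rewrite (probability_fibre_law P (fun a => [forall i, Z i a == v i]) mw).
have -> : (\prod_(i in [set: I]%SET) P (X i @^-1` [set v i]))%E =
    (\prod_i fin_prob (fibre_law P w) (fun a => Z i a == v i))%:E.
  rewrite (big_morph EFin EFinM erefl); apply: eq_big => [i|i _]; first by rewrite inE.
  rewrite -(probability_fibre_law P (fun a => Z i a == v i) mw); congr (P _).
  apply/seteqP; split => t /=.
    by rewrite XZ => ->; rewrite eqxx.
  by rewrite XZ => /eqP.
by case.
Qed.

Definition outcome (R : realType) (disp : measure_display) (T : measurableType disp)
    (b n : nat) (X : pauli_index b -> 'I_n -> {mfun T >-> R}) (t : T) :
    {ffun pauli_index b * 'I_n -> bool} :=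
  [ffun x => X x.1 x.2 t == 1].

(** A fibre is a finite intersection of events on single outcomes. *)
Lemma measurable_outcome (R : realType) (disp : measure_display)
    (T : measurableType disp) (b n : nat)
    (X : pauli_index b -> 'I_n -> {mfun T >-> R}) a :
  measurable (outcome X @^-1` [set a]).
Proof.
have -> : outcome X @^-1` [set a] = \bigcap_(x in [set: pauli_index b * 'I_n])
    X x.1 x.2 @^-1` (if a x then [set 1] else ~` [set 1]).
  apply/seteqP; split => t /=.
    move=> <- x _ /=; rewrite ffunE; by case: eqP.
  move=> H; apply/ffunP => x; rewrite ffunE; have := H x Logic.I.
  by rewrite /=; case: (a x) => /= [->|/eqP/negbTE]; rewrite ?eqxx.
apply: fin_bigcap_measurable => [|x _]; first exact: finite_finset.
rewrite -[X in measurable X]setTI; apply: measurable_funP => //.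
case: (a x); [exact: measurable_set1 | by apply: measurableC; exact: measurable_set1].
Qed.

(** * Pauli matrices *)

Section PauliMatrices.
Local Open Scope complex_scope.
Local Open Scope sesquilinear_scope.

Lemma mxtrace_cast (K : nzRingType) m n (e : m = n) (A : 'M[K]_m) :
  \tr (castmx (e, e) A) = \tr A.
Proof. by case: n / e; rewrite castmx_id. Qed.

Lemma mulmx_castmx (K : nzRingType) m n (e : m = n) (A B : 'M[K]_m) :
  castmx (e, e) A *m castmx (e, e) B = castmx (e, e) (A *m B).
Proof. by case: n / e; rewrite !castmx_id. Qed.

Lemma castmx1 (K : nzRingType) m n (e : m = n) :
  castmx (e, e) 1%:M = 1%:M :> 'M[K]_n.
Proof. by case: n / e; rewrite castmx_id. Qed.

Lemma tensmx11 (K : comNzRingType) m n :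
  mxtens.tensmx 1%:M 1%:M = 1%:M :> 'M[K]_(m * n).
Proof.
apply/matrixP => i j.
case: (mxtens.mxtens_indexP i) => i0 i1; case: (mxtens.mxtens_indexP j) => j0 j1.
rewrite mxtens.tensmxE !mxE (can_eq (@mxtens.mxtens_indexK _ _)).
by rewrite -natrM mulnb.
Qed.

Lemma mxtrace_tens (K : comNzRingType) m n (A : 'M[K]_m) (B : 'M[K]_n) :
  \tr (mxtens.tensmx A B) = \tr A * \tr B.
Proof.
rewrite /mxtrace mxtens.mulr_sum; apply: eq_bigr => i _.
case: (mxtens.mxtens_indexP i) => i0 i1.
by rewrite mxtens.tensmxE mxtens.mxtens_indexK.
Qed.

Lemma trmxC_tens (C : numClosedFieldType) m n p q (A : 'M[C]_(m, n))
    (B : 'M[C]_(p, q)) :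
  (mxtens.tensmx A B) ^t* = mxtens.tensmx (A ^t*) (B ^t*).
Proof. by rewrite mxtens.trmx_tens mxtens.map_mxT. Qed.

Lemma mxtrace_pauli2M (R : realType) (l m : 'I_4) :
  \tr (pauli2 l *m pauli2 m : 'M[R[i]]_2) = 2 * (l == m)%:R.
Proof.
have ii : Num.imaginary * Num.imaginary = -1 :> R[i] by rewrite -expr2 sqrCi.
rewrite /mxtrace !big_ord_recl big_ord0 /= !mxE !big_ord_recl !big_ord0.
case: l => -[|[|[|[|//]]]] hl; case: m => -[|[|[|[|//]]]] hm;
  rewrite /pauli2 -[_ == _]/(_ == _)%N /= !mxE /= ?complexiE /bump /= ?expr0 ?expr1;
  rewrite ?mulrN ?mulNr ?ii; ring.
Qed.

Lemma pauli2_herm (R : realType) (l : 'I_4) :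
  (pauli2 l : 'M[R[i]]_2) ^t* = pauli2 l.
Proof.
apply/matrixP => i j; rewrite !mxE /pauli2.
case: l => -[|[|[|[|//]]]] hl /=; rewrite !mxE /= ?complexiE //.
- by rewrite eq_sym conjC_nat.
- by rewrite eq_sym conjC_nat.
- by case: i => -[|[|//]] hi; case: j => -[|[|//]] hj;
    rewrite -![_ == _ :> 'I_2]/(_ == _)%N /= ?conjC0 // ?rmorphN /= ?conjCi ?opprK.
- by rewrite eq_sym; case: eqVneq => [->|_];
    rewrite ?conjC0 // rmorphXn rmorphN rmorph1.
Qed.

Lemma pauli2_sqr (R : realType) (l : 'I_4) :
  pauli2 l *m pauli2 l = 1%:M :> 'M[R[i]]_2.
Proof.
have ii : Num.imaginary * Num.imaginary = -1 :> R[i] by rewrite -expr2 sqrCi.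
apply/matrixP => i j; rewrite !mxE !big_ord_recl big_ord0 /pauli2.
case: l => -[|[|[|[|//]]]] hl /=; rewrite !mxE /= ?complexiE //;
 case: i => -[|[|//]] hi; case: j => -[|[|//]] hj;
 rewrite -![_ == _ :> 'I_2]/(_ == _)%N /= ?mulr0n ?mulr1n /bump /= ?expr0 ?expr1;
 rewrite ?mulrN ?mulNr ?ii; ring.
Qed.

Lemma pauli_tensor_herm (R : realType) b (l : 'I_b -> 'I_4) :
  (pauli_tensor l : 'M[R[i]]_(2 ^ b)) ^t* = pauli_tensor l.
Proof.
elim: b l => [|b IH] l /=; first by rewrite trmx1 map_mx1.
by rewrite trmx_cast map_castmx trmxC_tens pauli2_herm IH.
Qed.

Lemma pauli_tensor_sqr (R : realType) b (l : 'I_b -> 'I_4) :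
  pauli_tensor l *m pauli_tensor l = 1%:M :> 'M[R[i]]_(2 ^ b).
Proof.
elim: b l => [|b IH] l /=; first by rewrite mulmx1.
rewrite mulmx_castmx mxtens.tensmx_mul pauli2_sqr IH.
by rewrite tensmx11 castmx1.
Qed.

Lemma mxtrace_pauli_tensorM (R : realType) b (l m : 'I_b -> 'I_4) :
  \tr (pauli_tensor l *m pauli_tensor m : 'M[R[i]]_(2 ^ b)) =
  (2 ^ b)%:R * [forall i, l i == m i]%:R.
Proof.
elim: b l m => [|b IH] l m /=.
  rewrite mulmx1 mxtrace1 expn0 mul1r.
  by rewrite (_ : [forall i, _]) //; apply/forallP => -[].
rewrite mulmx_castmx mxtrace_cast mxtens.tensmx_mul mxtrace_tens.
rewrite mxtrace_pauli2M IH.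
have -> : [forall i, l i == m i] = (l ord0 == m ord0) &&
    [forall i : 'I_b, l (lift ord0 i) == m (lift ord0 i)].
  apply/forallP/andP => [H|[H0 /forallP H] i]; first by split => //; exact/forallP.
  by case: (unliftP ord0 i) => [j ->|->].
by rewrite expnS natrM -mulnb natrM mulrACA.
Qed.

Lemma trmxCZ (C : numClosedFieldType) m n (c : C) (A : 'M[C]_(m, n)) :
  (c *: A) ^t* = c^*%R *: A ^t*.
Proof. by apply/matrixP => i j; rewrite !mxE rmorphM. Qed.

(** [Q = (1 + a B) / 2] is a Hermitian idempotent with row space the
    eigenspace, and these properties characterise the orthogonal projection. *)
Lemma proj_ortho_eigenspace_involution (C : numClosedFieldType) d
    (B : 'M[C]_d) (a : C) :
  B ^t* = B -> B *m B = 1%:M -> a^*%R = a -> a * a = 1 ->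
  proj_ortho (eigenspace B a) = 2^-1 *: (1%:M + a *: B).
Proof.
move=> hB BB ha aa.
set Q := _ *: _.
have two0 : (2 : C) != 0 by rewrite pnatr_eq0.
have QB : Q *m B = a *: Q.
  rewrite /Q -scalemxAl mulmxDl mul1mx -scalemxAl BB !scalerDr !scalerA.
  by rewrite [a / 2 * a]mulrAC aa mul1r [a / 2]mulrC addrC.
have hQ : Q ^t* = Q.
  rewrite trmxCZ fmorphV /= conjC_nat; congr (_ *: _).
  by rewrite raddfD /= map_mxD trmx1 map_mx1 trmxCZ ha hB.
have QQ : Q *m Q = Q.
  rewrite {2}/Q -scalemxAr mulmxDr mulmx1 -scalemxAr QB scalerA aa scale1r.
  by rewrite -mulr2n -scaler_nat scalerA mulVf // scale1r.
set U := eigenspace B a.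
have QU : (Q <= U)%MS by apply/eigenspaceP.
have UB : U *m B = a *: U by apply/eigenspaceP.
have UQ : U *m Q = U.
  rewrite /Q -scalemxAr mulmxDr mulmx1 -scalemxAr UB scalerA aa scale1r.
  by rewrite -mulr2n -scaler_nat scalerA mulVf // scale1r.
(* Split the identity as [(1 - Q) + Q]: the projection fixes [Q], and kills
   [1 - Q], whose rows are orthogonal to the eigenspace. *)
rewrite -[LHS]mul1mx -[1%:M](addrNK Q) mulmxDl [Q *m _]proj_ortho_id //.
rewrite proj_ortho_0 ?add0r //; apply/orthomx1P.
by rewrite -UQ trmx_mul map_mxM hQ mulmxA mulmxBl mul1mx QQ subrr mul0mx.
Qed.

Lemma pauli_tensor0 (R : realType) b :
  pauli_tensor (fun=> ord0) = 1%:M :> 'M[R[i]]_(2 ^ b).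
Proof. by elim: b => [//|b IH] /=; rewrite IH tensmx11 castmx1. Qed.

Lemma mxtrace_pauliM (R : realType) b (j k : pauli_index b) :
  \tr (pauli j *m pauli k : 'M[R[i]]_(2 ^ b)) = (2 ^ b)%:R * (j == k)%:R.
Proof.
rewrite mxtrace_pauli_tensorM; congr (_ * (_ : bool)%:R).
apply/forallP/eqP => [H|-> //]; apply/val_inj/ffunP => i; exact/eqP.
Qed.

Lemma mxtrace_pauli (R : realType) b (k : pauli_index b) :
  \tr (pauli k : 'M[R[i]]_(2 ^ b)) = 0.
Proof.
rewrite -[pauli k]mulmx1 -pauli_tensor0 mxtrace_pauli_tensorM.
case: forallP => [H|_]; last by rewrite mulr0.
case/negP: (valP k); apply/eqP/ffunP => i; rewrite ffunE; exact/eqP.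
Qed.

Lemma mxtrace_pauli_expansionM (R : realType) b (beta : pauli_index b -> R) k :
  \tr (pauli_expansion beta *m pauli k) = (beta k)%:C.
Proof.
rewrite /pauli_expansion -scalemxAl mxtraceZ mulmxDl mul1mx mxtraceD.
rewrite mxtrace_pauli add0r mulmx_suml raddf_sum /= (bigD1 k) //= big1 => [|j jk].
  rewrite addr0 -scalemxAl mxtraceZ mxtrace_pauliM eqxx mulr1.
  by rewrite mulrCA mulVf ?mulr1 // pnatr_eq0 expn_eq0.
by rewrite -scalemxAl mxtraceZ mxtrace_pauliM (negbTE jk) !mulr0.
Qed.

Lemma born_prob_pauli (R : realType) b (beta : pauli_index b -> R) k (a : R) :
  \tr (pauli_expansion beta) = 1 -> a * a = 1 ->
  born_prob (pauli_expansion beta) (eigenproj (pauli k) a%:C) =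
  (1 + a * beta k) / 2.
Proof.
move=> tr1 aa; rewrite /born_prob /eigenproj proj_ortho_eigenspace_involution.
- rewrite -scalemxAr mxtraceZ mulmxDr mulmx1 mxtraceD tr1 -scalemxAr mxtraceZ.
  rewrite mxtrace_pauli_expansionM.
  have -> : 2^-1 * (1 + a%:C * (beta k)%:C) = ((1 + a * beta k) / 2)%:C.
    by rewrite !rmorphM rmorphD rmorphM fmorphV rmorph1 rmorph_nat mulrC.
  by [].
- exact: pauli_tensor_herm.
- exact: pauli_tensor_sqr.
- exact: conjc_real.
- by rewrite -rmorphM aa rmorph1.
Qed.

Lemma pauli_expansionB (R : realType) b (f g : pauli_index b -> R) :
  pauli_expansion f - pauli_expansion g =
  ((2 ^ b)%:R)^-1 *: \sum_k (f k - g k)%:C *: pauli k.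
Proof.
rewrite /pauli_expansion -scalerBr opprD addrACA subrr add0r -sumrB.
by congr (_ *: _); apply: eq_bigr => k _; rewrite rmorphB scalerBl.
Qed.

Lemma cmod_sqr (R : realType) (z : R[i]) : (cmod z ^+ 2)%:C = z * z^*%R.
Proof. by rewrite /cmod normc_def /= rmorphXn /= -normc_def sqr_normc. Qed.

Lemma cmod_ge0 (R : realType) (z : R[i]) : 0 <= cmod z.
Proof. by rewrite /cmod normc_def /= sqrtr_ge0. Qed.

Lemma cmodE (R : realType) (z : R[i]) : (cmod z)%:C = `|z|.
Proof. by rewrite /cmod normc_def. Qed.

Lemma cmodM (R : realType) (y z : R[i]) : cmod (y * z) = cmod y * cmod z.
Proof. by apply: (@complexI R); rewrite rmorphM /= !cmodE normrM. Qed.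

Lemma cmod_real (R : realType) (x : R) : cmod x%:C = `|x|.
Proof. by rewrite /cmod normc_def /= expr0n addr0 sqrtr_sqr. Qed.

Lemma cmod_sum (R : realType) (I : finType) (F : I -> R[i]) :
  cmod (\sum_i F i) <= \sum_i cmod (F i).
Proof.
rewrite -lecR rmorph_sum /= cmodE; under [leRHS]eq_bigr do rewrite cmodE.
exact: ler_norm_sum.
Qed.

Lemma sum_cmod_sqr (R : realType) m n (A : 'M[R[i]]_(m, n)) :
  (\sum_i \sum_j cmod (A i j) ^+ 2)%:C = \tr (A *m A ^t*).
Proof.
rewrite rmorph_sum /mxtrace /=; apply: eq_bigr => i _.
rewrite rmorph_sum mxE /=; apply: eq_bigr => j _.
by rewrite !mxE cmod_sqr.
Qed.

Lemma sum_cmod_sqr_unitary (R : realType) d (B : 'M[R[i]]_d) (x : 'cV_d) :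
  B ^t* *m B = 1%:M ->
  \sum_i cmod ((B *m x) i 0) ^+ 2 = \sum_i cmod (x i 0) ^+ 2.
Proof.
move=> BB; apply: (@complexI R).
have E (y : 'cV[R[i]]_d) : (\sum_i cmod (y i 0) ^+ 2)%:C = \tr (y *m y ^t*).
  rewrite -sum_cmod_sqr; congr (_%:C); apply: eq_bigr => i _.
  by rewrite big_ord_recl big_ord0 addr0.
rewrite !E trmx_mul map_mxM mxtrace_mulC -mulmxA [_ *m (B *m x)]mulmxA BB mul1mx.
by rewrite mxtrace_mulC.
Qed.

(** Jensen's inequality for the square, with unnormalised weights [c]. *)
Lemma sqr_sum_le_weighted (R : realType) (I : finType) (c v : I -> R) :
  (forall i, 0 <= c i) ->
  (\sum_i c i * v i) ^+ 2 <= (\sum_i c i) * \sum_i c i * v i ^+ 2.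
Proof.
move=> c0; rewrite expr2 !big_distrlr /=.
have E : \sum_i \sum_j c i * (c j * v j ^+ 2) =
   \sum_i \sum_j c i * c j * ((v i ^+ 2 + v j ^+ 2) / 2).
  pose S := \sum_i \sum_j c i * (c j * v j ^+ 2).
  have S2 : S = \sum_i \sum_j c i * c j * v i ^+ 2.
    by rewrite /S exchange_big; do 2![apply: eq_bigr => ? _]; ring.
  have -> : \sum_i \sum_j c i * (c j * v j ^+ 2) = (S + S) / 2 by rewrite -/S; field.
  rewrite {1}S2 /S -big_split /= mulr_suml; apply: eq_bigr => i _.
  rewrite -big_split /= mulr_suml; apply: eq_bigr => j _; ring.
rewrite E; apply: ler_sum => i _; apply: ler_sum => j _.
rewrite (_ : _ * _ * _ = c i * c j * (v i * v j)); last by ring.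
apply: ler_wpM2l; first exact: mulr_ge0.
by rewrite -subr_ge0; have := sqr_ge0 (v i - v j); nra.
Qed.

(** Applying the weighted Jensen inequality in each coordinate and then summing
    over coordinates spares the triangle inequality for [l2norm]. *)
Lemma l2norm_sum_unitary (R : realType) d (I : finType) (c : I -> R)
    (B : I -> 'M[R[i]]_d) (x : 'cV_d) :
  (forall k, (B k) ^t* *m B k = 1%:M) -> l2norm x = 1 ->
  l2norm ((\sum_k (c k)%:C *: B k) *m x) <= \sum_k `|c k|.
Proof.
move=> BB x1.
have sx : \sum_i cmod (x i 0) ^+ 2 = 1.
  rewrite -[LHS]sqr_sqrtr ?sumr_ge0 //.
  - by move: x1; rewrite /l2norm => ->; rewrite expr1n.
  - by move=> i _; exact: sqr_ge0.
have S0 : 0 <= \sum_k `|c k| by exact: sumr_ge0.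
rewrite /l2norm -[leRHS]ger0_norm // -sqrtr_sqr ler_wsqrtr //.
apply: (@le_trans _ _ (\sum_i (\sum_k `|c k|) *
    \sum_k `|c k| * cmod ((B k *m x) i 0) ^+ 2)).
  apply: ler_sum => i _; apply: le_trans (sqr_sum_le_weighted _ _) => [|k]; last first.
    exact: normr_ge0.
  rewrite ler_sqr ?nnegrE ?cmod_ge0 //; last first.
    by apply: sumr_ge0 => k _; rewrite mulr_ge0 // cmod_ge0.
  rewrite mulmx_suml summxE (le_trans (cmod_sum _)) //.
  by apply: ler_sum => k _; rewrite -scalemxAl mxE cmodM cmod_real.
rewrite -mulr_sumr expr2 ler_wpM2l // exchange_big /=.
apply: ler_sum => k _; rewrite -mulr_sumr sum_cmod_sqr_unitary // sx.
by rewrite mulr1.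
Qed.

(** The case split in the proof covers [d = 0], where there is no unit vector
    and the supremum of the empty set is [0]. *)
Lemma spectral_norm_le (R : realType) d (A : 'M[R[i]]_d) (M : R) :
  0 <= M -> (forall x : 'cV_d, l2norm x = 1 -> l2norm (A *m x) <= M) ->
  0 <= spectral_norm A <= M.
Proof.
move=> M0 AM; rewrite /spectral_norm; set S := [set _ | _ in _].
have ubM : ubound S M by move=> _ [x /= x1 <-]; exact: AM.
have [->|/set0P[y Sy]] := eqVneq S set0; first by rewrite sup0 lexx.
rewrite ge_sup //; last by exists y.
rewrite andbT; apply: le_trans (ub_le_sup _ Sy); last by exists M.
by case: Sy => x _ <-; exact: sqrtr_ge0.
Qed.

Lemma spectral_norm_pauli_expansionB (R : realType) b (f g : pauli_index b -> R) :
  spectral_norm (pauli_expansion f - pauli_expansion g) ^+ 2 <=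
  ((2 ^ b)%:R ^+ 2)^-1 * (\sum_k `|f k - g k|) ^+ 2.
Proof.
have d0 : (0 : R) <= ((2 ^ b)%:R)^-1 by rewrite invr_ge0.
have S0 : 0 <= \sum_k `|f k - g k| by exact: sumr_ge0.
suff /andP[n0 n1] : 0 <= spectral_norm (pauli_expansion f - pauli_expansion g) <=
    ((2 ^ b)%:R)^-1 * \sum_k `|f k - g k|.
  by rewrite -exprVn -exprMn ler_sqr ?nnegrE ?mulr_ge0.
apply: spectral_norm_le => [|x x1]; first exact: mulr_ge0.
rewrite pauli_expansionB scaler_sumr mulr_sumr.
have E : \sum_k ((2 ^ b)%:R)^-1 *: ((f k - g k)%:C *: pauli k) =
    \sum_k (((2 ^ b)%:R)^-1 * (f k - g k))%:C *: pauli k :> 'M[R[i]]_(2 ^ b).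
  by apply: eq_bigr => k _; rewrite scalerA rmorphM fmorphV rmorph_nat.
rewrite E (le_trans (l2norm_sum_unitary _ _ x1)) //.
  by move=> k; rewrite pauli_tensor_herm pauli_tensor_sqr.
by apply: ler_sum => k _; rewrite normrM ger0_norm.
Qed.

Lemma frobenius_norm_pauli_expansionB (R : realType) b (f g : pauli_index b -> R) :
  frobenius_norm (pauli_expansion f - pauli_expansion g) ^+ 2 =
  ((2 ^ b)%:R)^-1 * \sum_k (f k - g k) ^+ 2.
Proof.
rewrite /frobenius_norm sqr_sqrtr; last first.
  by apply: sumr_ge0 => i _; apply: sumr_ge0 => j _; exact: sqr_ge0.
have d0 : (2 ^ b)%:R != 0 :> R[i] by rewrite pnatr_eq0 expn_eq0.
apply: (@complexI R); rewrite sum_cmod_sqr pauli_expansionB.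
set D := \sum_k _.
have hD : D ^t* = D.
  rewrite /D raddf_sum /= raddf_sum /=; apply: eq_bigr => k _.
  by rewrite trmxCZ pauli_tensor_herm [X in X *: _]conjc_real.
rewrite trmxCZ hD -scalemxAl -scalemxAr !mxtraceZ fmorphV /= conjC_nat.
have -> : \tr (D *m D) = (2 ^ b)%:R * (\sum_k (f k - g k) ^+ 2)%:C.
  rewrite {1}/D mulmx_suml raddf_sum rmorph_sum mulr_sumr /=.
  apply: eq_bigr => k _; rewrite -scalemxAl mxtraceZ /D mulmx_sumr raddf_sum /=.
  rewrite (bigD1 k) //= big1 => [|j jk].
    rewrite addr0 -scalemxAr mxtraceZ mxtrace_pauliM eqxx mulr1 expr2 rmorphM.
    by rewrite mulrCA mulrC [_ * (2 ^ b)%:R]mulrC mulrA.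
  by rewrite -scalemxAr mxtraceZ mxtrace_pauliM eq_sym (negbTE jk) !mulr0.
by rewrite rmorphM fmorphV rmorph_nat mulKf.
Qed.

End PauliMatrices.

(** * Risk of the thresholding estimator *)

(** Here [dd] plays the role of [d^2]: it bounds the number of coefficients, and
    twice its inverse bounds the Chernoff functional of each of them.  As these two cancel,
    the deviations beyond [t] contribute only a multiple of [t^2] to either
    risk. *)
Lemma fin_expect_threshold_risk (R : realType) (W K : finType) (p : W -> R)
    (r : thresholding) (h t dd : R) (l : R) (N : K -> W -> R) (beta : K -> R) :
  1 < h -> 0 < t -> 2 <= l * t -> 0 < dd -> #|K|%:R <= dd ->
  (forall w, 0 <= p w) -> \sum_w p w = 1 ->
  (forall v : K -> R, fin_prob p (fun w => [forall k, N k w == v k]) =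
     \prod_k fin_prob p (fun w => N k w == v k)) ->
  (forall k, fin_expect p (fun w => expR (l * (N k w - beta k - t)) +
       expR (l * (- (N k w - beta k) - t))) <= 2 * dd^-1) ->
  let C := (h + 1) * h / (h - 1) in
  let D k w := threshold r (h * t) (N k w) - beta k in
  fin_expect p (fun w => (\sum_k `|D k w|) ^+ 2) <=
    2 * C ^+ 2 * ((\sum_k Num.min `|beta k| t) ^+ 2 + 6 * t ^+ 2) /\
  fin_expect p (fun w => \sum_k D k w ^+ 2) <=
    2 * C ^+ 2 * (\sum_k Num.min `|beta k| t ^+ 2 + 2 * t ^+ 2).
Proof.
move=> h1 t0 lt2 dd0 Kd p0 p1 indep Ztail C D.
have C0 : 0 <= C by rewrite /C divr_ge0 ?mulr_ge0 //; lra.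
(* The part of the error beyond the deviation level, as a function of [N k]
   alone so that independence applies. *)
pose g k (x : R) := `|x - beta k| * (t < `|x - beta k|)%R%:R.
pose Y k w := g k (N k w).
pose m k := Num.min `|beta k| t.
have m0 k : 0 <= m k by rewrite le_min normr_ge0 ltW.
have Y0 k w : 0 <= Y k w by rewrite mulr_ge0.
have DY k w : `|D k w| <= C * (m k + Y k w) by exact: threshold_error.
clearbody C D.
have EY k : 0 <= fin_expect p (Y k) <= t * (2 * dd^-1).
  apply/andP; split; first by apply: sumr_ge0 => w _; exact: mulr_ge0.
  apply: le_trans (ler_wpM2l (ltW t0) (Ztail k)); rewrite -fin_expectZ.
  by apply: fin_expect_le => // w; case: (expR_dominates_tail (N k w - beta k) t0 lt2).
have EY2 k : fin_expect p (fun w => Y k w ^+ 2) <= t ^+ 2 * (2 * dd^-1).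
  apply: le_trans (ler_wpM2l (sqr_ge0 t) (Ztail k)); rewrite -fin_expectZ.
  by apply: fin_expect_le => // w; case: (expR_dominates_tail (N k w - beta k) t0 lt2).
have sq2 (x y : R) : (x + y) ^+ 2 <= 2 * (x ^+ 2 + y ^+ 2).
  by have := sqr_ge0 (x - y); nra.
have Kdd : #|K|%:R * dd^-1 <= 1 by rewrite ler_pdivrMr // mul1r.
have Kdd0 : 0 <= #|K|%:R * dd^-1 by rewrite divr_ge0 // ltW.
split.
- apply: (@le_trans _ _ (fin_expect p (fun w =>
      2 * C ^+ 2 * ((\sum_k m k) ^+ 2 + (\sum_k Y k w) ^+ 2)))).
    apply: fin_expect_le => // w.
    apply: (@le_trans _ _ ((C * (\sum_k m k + \sum_k Y k w)) ^+ 2)).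
      rewrite ler_sqr ?nnegrE ?mulr_ge0 ?addr_ge0 ?sumr_ge0 //.
      by rewrite -big_split mulr_sumr /=; apply: ler_sum => k _; exact: DY.
    rewrite exprMn [2 * C ^+ 2]mulrC -[leRHS]mulrA ler_wpM2l ?sqr_ge0 //.
  rewrite fin_expectZ fin_expectD fin_expect_cst // ler_wpM2l ?mulr_ge0 ?sqr_ge0 //.
  rewrite lerD2l; apply: le_trans (fin_expect_sqr_sum EY EY2 _) _.
    by move=> j k jk; apply: (fin_expect_mul g p1 indep jk).
  have -> : #|K|%:R * (t ^+ 2 * (2 * dd^-1)) + (#|K|%:R * (t * (2 * dd^-1))) ^+ 2 =
      t ^+ 2 * (2 * (#|K|%:R * dd^-1) + 4 * (#|K|%:R * dd^-1) ^+ 2) by ring.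
  rewrite mulrC ler_wpM2r ?sqr_ge0 //; nra.
- apply: (@le_trans _ _ (fin_expect p (fun w =>
      2 * C ^+ 2 * (\sum_k m k ^+ 2 + \sum_k Y k w ^+ 2)))).
    apply: fin_expect_le => // w; rewrite -big_split mulr_sumr /=.
    apply: ler_sum => k _.
    apply: (@le_trans _ _ ((C * (m k + Y k w)) ^+ 2)).
      by rewrite -[leLHS]real_normK ?num_real // ler_sqr ?nnegrE ?mulr_ge0 ?addr_ge0.
    by rewrite exprMn [2 * C ^+ 2]mulrC -[leRHS]mulrA ler_wpM2l ?sqr_ge0.
  rewrite fin_expectZ fin_expectD fin_expect_cst // ler_wpM2l ?mulr_ge0 ?sqr_ge0 //.
  rewrite lerD2l fin_expect_sum.
  apply: (@le_trans _ _ (\sum_(k : K) t ^+ 2 * (2 * dd^-1))).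
    by apply: ler_sum => k _; exact: EY2.
  have -> : \sum_(k : K) t ^+ 2 * (2 * dd^-1) = t ^+ 2 * (2 * (#|K|%:R * dd^-1)).
    by rewrite sumr_const -[LHS]mulr_natl; ring.
  rewrite mulrC ler_wpM2r ?sqr_ge0 //; nra.
Qed.

Lemma ln_div_le1 (R : realType) (c1 : R) (n d : nat) : c1 < 1 ->
  (0 < n)%N -> (1 < d)%N -> d%:R <= expR (n%:R `^ c1) ->
  ln d%:R / n%:R <= 1 :> R.
Proof.
move=> c11 n0 d1 dn.
have n1 : 1 <= n%:R :> R by rewrite ler1n.
have nn : 0 < n%:R :> R by rewrite ltr0n.
rewrite ler_pdivrMr // mul1r.
rewrite -(ler_expR (ln _)) lnK ?posrE ?ltr0n 1?ltnW // (le_trans dn) // ler_expR.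
by rewrite -[leRHS]powRr1 ?ler0n // ler_powR // ltW.
Qed.

(** Used at [4 L = t^2], to pass from powers of [t] to powers of [L]. *)
Lemma le_powR_scale4 (R : realType) (L e : R) : 0 < L <= 1 -> 0 <= e <= 1 ->
  (4 * L) `^ e <= 4 * L `^ e /\ L <= L `^ e.
Proof.
move=> /andP[L0 L1] /andP[e0 e1]; split.
  rewrite powRM ?(ltW L0) // ler_wpM2r ?powR_ge0 //.
  by rewrite -[leRHS]powRr1 // ler_powR // ler1n.
by rewrite -[leLHS](powRr1 (ltW L0)) ger_powR // L0.
Qed.

Lemma card_pauli_index b : (#|pauli_index b| <= (2 ^ b) ^ 2)%N.
Proof.
rewrite card_sig (leq_trans (max_card _)) // card_ffun !card_ord.
by rewrite -expnM mulnC expnM.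
Qed.

(** The constants: the sparse part contributes [4] and the deviations
    [6 * 4] (spectral) or [2 * 4] (Frobenius), as [t^2 = 4 L]; the factor [2]
    from squaring a sum of two terms gives [2 * 28] and [2 * 12]. *)
Lemma pauli_expansion_risk (R : realType) (q h s : R) (r : thresholding)
    (b n : nat) (disp : measure_display) (T : measurableType disp)
    (P : probability T R) (X : pauli_index b -> 'I_n -> {mfun T >-> R})
    (beta : pauli_index b -> R) :
  let d := (2 ^ b)%N in let L : R := ln d%:R / n%:R in
  let C := (h + 1) * h / (h - 1) in
  let rho := pauli_expansion beta in
  0 <= q -> q < 1 -> 1 < h -> (0 < n)%N -> (0 < b)%N -> 1 <= s -> L <= 1 ->
  density_matrix rho -> pauli_data rho P X -> \sum_k abs_pow q (beta k) <= s ->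
  ('E_P[fun t => (spectral_norm (rho_hat r h X t - rho) ^+ 2)%R] <=
     (56 * C ^+ 2 * s ^+ 2 * (d%:R ^+ 2)^-1 * L `^ (1 - q))%:E)%E /\
  ('E_P[fun t => (frobenius_norm (rho_hat r h X t - rho) ^+ 2)%R] <=
     (24 * C ^+ 2 * s * d%:R^-1 * L `^ (1 - q / 2))%:E)%E.
Proof.
move=> d L C rho q0 q1 h1 n0 b0 s1.
have e1 : 0 <= 1 - q <= 1 by clear -q0 q1; apply/andP; split; lra.
have e2 : 0 <= 1 - q / 2 <= 1 by clear -q0 q1; apply/andP; split; lra.
have s0 : 0 <= s by rewrite (le_trans ler01).
have s2 : 1 <= s ^+ 2 by rewrite expr_ge1.
move=> L1 [_ _ tr1] [X1 Xp Xi Ni] bs.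
have d1 : (1 < d)%N by rewrite -(expn0 2) ltn_exp2l.
have d0 : 0 < d%:R :> R by rewrite ltr0n ltnW.
have nn : 0 < n%:R :> R by rewrite ltr0n.
have L0 : 0 < L by rewrite divr_gt0 ?ln_gt0 ?ltr1n.
pose t := Num.sqrt (4 / n%:R * ln d%:R : R).
have t2 : t ^+ 2 = 4 * L.
  rewrite sqr_sqrtr /L; first by field; rewrite gt_eqF.
  by rewrite mulr_ge0 ?divr_ge0 ?ln_ge0 // ler1n ltnW.
have t0 : 0 < t by rewrite sqrtr_gt0 mulr_gt0 ?divr_gt0 ?ln_gt0 ?ltr1n.
have nt2 : n%:R * t ^+ 2 = 4 * ln d%:R by rewrite t2 /L; field; rewrite gt_eqF.
(* This makes the Chernoff parameter [n t] at least [2 / t]. *)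
have ln2 : 2^-1 <= ln d%:R :> R.
  rewrite -ler_expR lnK ?posrE // (@le_trans _ _ 2) ?ler_nat //.
  have e0 := expR_gt0 (- 2^-1 : R).
  have := expR_ge1Dx (- 2^-1 : R); rewrite expRN -[expR 2^-1]invrK.
  move: e0; rewrite expRN; set e := (expR 2^-1)^-1 => e0 ee.
  rewrite invf_ple ?posrE //; lra.
set w := outcome X.
set p := fibre_law P w.
have mw := measurable_outcome X.
have p0 a : 0 <= p a by exact: fibre_law_ge0.
have p1 : \sum_a p a = 1 by exact: sum_fibre_law.
pose x k i (a : {ffun pauli_index b * 'I_n -> bool}) : R := if a (k, i) then 1 else -1.
have n11 : (-1 == 1 :> R) = false by apply/eqP; lra.
have Xx k i u : X k i u = x k i (w u).
  by rewrite /x ffunE /=; case: (X1 k i u) => ->; rewrite ?eqxx ?n11.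
pose N k a := (\sum_i x k i a) / n%:R.
have NE k u : pauli_mean X k u = N k (w u).
  by rewrite /pauli_mean /N; congr (_ / _); apply: eq_bigr => i _.
have px k i c : (fin_prob p (fun a => x k i a == c))%:E = P (X k i @^-1` [set c]).
  rewrite -(probability_fibre_law P (fun a => x k i a == c) mw); congr (P _).
  by apply/seteqP; split=> u /=; rewrite Xx => /eqP.
have pp k i : fin_prob p (fun a => x k i a == 1) = (1 + beta k) / 2.
  apply: EFin_inj; rewrite px; case: (Xp k i) => -> _.
  have := @born_prob_pauli _ _ beta k 1 tr1 (mulr1 1); rewrite mul1r rmorph1.
  by move=> ->.
have pm k i : fin_prob p (fun a => x k i a == -1) = (1 - beta k) / 2.
  apply: EFin_inj; rewrite px; case: (Xp k i) => _ ->.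
  have := @born_prob_pauli _ _ beta k (-1) tr1 (etrans (mulrNN 1 1) (mulr1 1)).
  by rewrite mulN1r rmorphN rmorph1 => ->.
(* The probabilities of both outcomes being nonnegative bounds [beta k]. *)
have beta1 k : -1 <= beta k <= 1.
  have i0 : 'I_n by exact: Ordinal n0.
  have := pp k i0; have := pm k i0.
  have : 0 <= fin_prob p (fun a => x k i0 a == 1) by exact: sumr_ge0.
  have : 0 <= fin_prob p (fun a => x k i0 a == -1) by exact: sumr_ge0.
  by clear; move=> *; apply/andP; split; lra.
have tail k : fin_expect p (fun a => expR (n%:R * t * (N k a - beta k - t)) +
       expR (n%:R * t * (- (N k a - beta k) - t))) <= 2 * (d%:R ^+ 2)^-1.
  have := @fin_expect_tail _ _ p n (x k) (fun a => N k a - beta k) (beta k) t n0.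
  have -> : expR (- (n%:R * t ^+ 2 / 2)) = (d%:R ^+ 2)^-1.
    rewrite nt2 expRN; congr (_^-1).
    have -> : 4 * ln d%:R / 2 = 2%:R * ln d%:R :> R by field.
    by rewrite expRM_natl lnK ?posrE.
  apply => //.
  - by move=> i a; rewrite /x; case: ifP; [left | right].
  - exact: (fibre_law_indep mw (Xx k) (Xi k)).
have Kd : #|pauli_index b|%:R <= d%:R ^+ 2 :> R.
  by rewrite -natrX ler_nat card_pauli_index.
have lt2 : 2 <= n%:R * t * t by rewrite -mulrA -expr2 nt2; lra.
have [risk1 risk2] := @fin_expect_threshold_risk _ _ _ p r h t (d%:R ^+ 2) (n%:R * t)
  N beta h1 t0 lt2 (exprn_gt0 _ d0) Kd p0 p1 (fibre_law_indep mw NE Ni) tail.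
have hat u : rho_hat r h X u =
    pauli_expansion (fun k => threshold r (h * t) (N k (w u))).
  by rewrite /rho_hat; congr pauli_expansion; apply/funext => k; rewrite NE.
have LL : 0 < L <= 1 by rewrite L0.
have [Lq LLq] := le_powR_scale4 LL e1.
have [Lq2 LLq2] := le_powR_scale4 LL e2.
have lp0 := powR_ge0 L (1 - q); have lp20 := powR_ge0 L (1 - q / 2).
have sum1 : (\sum_k Num.min `|beta k| t) ^+ 2 <= 4 * s ^+ 2 * L `^ (1 - q).
  have tq : (t `^ (1 - q)) ^+ 2 <= 4 * L `^ (1 - q).
    by rewrite -powR_mulrn ?powR_ge0 // powRAC powR_mulrn ?(ltW t0) // t2.
  apply: (@le_trans _ _ ((s * t `^ (1 - q)) ^+ 2)); last first.
    by rewrite exprMn [4 * _]mulrC -[leRHS]mulrA ler_wpM2l ?sqr_ge0.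
  rewrite ler_sqr ?nnegrE ?mulr_ge0 ?powR_ge0 //; last first.
    by apply: sumr_ge0 => k _; rewrite le_min normr_ge0 ltW.
  apply: le_trans (ler_wpM2r (powR_ge0 _ _) bs); rewrite mulr_suml.
  by apply: ler_sum => k _; exact: min_le_abs_pow.
have sum2 : \sum_k Num.min `|beta k| t ^+ 2 <= 4 * s * L `^ (1 - q / 2).
  apply: (@le_trans _ _ (s * (t ^+ 2) `^ (1 - q / 2))); last first.
    by rewrite t2 [4 * s]mulrC -[leRHS]mulrA ler_wpM2l.
  apply: le_trans (ler_wpM2r (powR_ge0 _ _) bs); rewrite mulr_suml.
  by apply: ler_sum => k _; exact: sqr_min_le_abs_pow.
have dV0 : 0 <= d%:R^-1 :> R by rewrite invr_ge0 ltW.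
have C2 : 0 <= 2 * C ^+ 2 by rewrite mulr_ge0 ?sqr_ge0.
split.
- pose f a := spectral_norm
      (pauli_expansion (fun k => threshold r (h * t) (N k a)) - rho) ^+ 2.
  rewrite (_ : (fun u => _) = (fun u => f (w u)));
    last by apply/funext => u; rewrite hat.
  rewrite (@expectation_fibre_law _ _ _ P _ w f mw) => [|a]; last exact: sqr_ge0.
  rewrite lee_fin; apply: (@le_trans _ _ ((d%:R ^+ 2)^-1 * fin_expect p (fun a =>
     (\sum_k `|threshold r (h * t) (N k a) - beta k|) ^+ 2))).
    rewrite -fin_expectZ; apply: fin_expect_le => // a.
    exact: spectral_norm_pauli_expansionB.
  rewrite (_ : 56 * _ * _ * _ * _ = (d%:R ^+ 2)^-1 *
    (2 * C ^+ 2 * (28 * s ^+ 2 * L `^ (1 - q)))); last by ring.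
  rewrite ler_wpM2l ?invr_ge0 ?sqr_ge0 //; apply: (le_trans risk1).
  rewrite ler_wpM2l //.
  have : L `^ (1 - q) <= s ^+ 2 * L `^ (1 - q) by rewrite ler_peMl.
  rewrite t2 => H; move: sum1; rewrite -!mulrA => sum1; clear -H sum1 LLq; lra.
- pose f a := frobenius_norm
      (pauli_expansion (fun k => threshold r (h * t) (N k a)) - rho) ^+ 2.
  rewrite (_ : (fun u => _) = (fun u => f (w u)));
    last by apply/funext => u; rewrite hat.
  rewrite (@expectation_fibre_law _ _ _ P _ w f mw) => [|a]; last exact: sqr_ge0.
  have -> : f = fun a => d%:R^-1 * \sum_k (threshold r (h * t) (N k a) - beta k) ^+ 2.
    by apply/funext => a; exact: frobenius_norm_pauli_expansionB.
  rewrite fin_expectZ lee_fin.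
  rewrite (_ : 24 * _ * _ * _ * _ = d%:R^-1 *
    (2 * C ^+ 2 * (12 * s * L `^ (1 - q / 2)))); last by ring.
  rewrite ler_wpM2l //; apply: (le_trans risk2); rewrite ler_wpM2l //.
  have : L `^ (1 - q / 2) <= s * L `^ (1 - q / 2) by rewrite ler_peMl.
  rewrite t2 => H; move: sum2; rewrite -!mulrA => sum2; clear -H sum2 LLq2; lra.
Qed.

Theorem theorem1 (R : realType) (q c0 c1 h : R)
    (hq0 : 0 <= q) (hq1 : q < 1) (hc0 : 0 < c0) (hc1 : c1 < 1) (hh : 1 < h) :
  exists c2 c3 : R,
    forall (pi_ : nat -> nat -> R) (r : thresholding) (n b : nat),
      let d := (2 ^ b)%N in
      (0 < n)%N -> (0 < b)%N ->
      1 <= pi_ n d ->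
      n%:R `^ c0 <= d%:R -> d%:R <= expR (n%:R `^ c1) ->
      forall (disp : measure_display) (T : measurableType disp)
        (P : 'M[complex R]_(2 ^ b) -> probability T R)
        (X : pauli_index b -> 'I_n -> {mfun T >-> R}),
        (forall rho, density_matrix rho -> pauli_data rho (P rho) X) ->
        let Theta := sparse_density q (pi_ n d) in
        (max_risk spectral_norm Theta P r h X <=
           (c2 * pi_ n d ^+ 2 * (d%:R ^+ 2)^-1 *
              (ln d%:R / n%:R) `^ (1 - q))%:E)%E /\
        (max_risk frobenius_norm Theta P r h X <=
           (c3 * pi_ n d * d%:R^-1 *
              (ln d%:R / n%:R) `^ (1 - q / 2))%:E)%E.

Proof.
exists (56 * ((h + 1) * h / (h - 1)) ^+ 2), (24 * ((h + 1) * h / (h - 1)) ^+ 2).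
move=> pi_ r n b d n0 b0 pi1 _ dn disp T P X data Theta.
have d1 : (1 < d)%N by rewrite -(expn0 2) ltn_exp2l.
have L1 := ln_div_le1 hc1 n0 d1 dn.
split; apply: ge_ereal_sup => _ [rho [drho [beta [rhoE bs]]] <-];
  have := data _ drho; move: drho; rewrite rhoE => drho drho_data;
  by have [] := @pauli_expansion_risk _ q h _ r b n disp T (P _) X beta
    hq0 hq1 hh n0 b0 pi1 L1 drho drho_data bs.
Qed.
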